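(* Let $\mathbf{A}=(A_-,A_+,A)$ be an invariant relation, and assume that for all $z\in A_-$ there exists $a\in A_+$ such that $z\mathrel{A}a$. Assuming Martin's Conjecture, the Turing equivalence relation $\equiv_T$ is not Borel non-$\mathbf{A}$.
   Context: If $E$, $F$ are equivalence relations on standard Borel spaces $X$, $Y$, a Borel homomorphism from $E$ to $F$ (written $f\colon E\to F$) is a Borel function $f\colon X\to Y$ such that $x\mathrel{E}x'$ implies $f(x)\mathrel{F}f(x')$. For a standard Borel space $Z$, $E_{\mathsf{set}}(Z)$ is the equivalence relation on $Z^\omega$ given by $\langle z_n\rangle\mathrel{E_{\mathsf{set}}(Z)}\langle z_n'\rangle$ iff $\{z_n:n\in\omega\}=\{z'_n:n\in\omega\}$. For $Z$ a subset of $2^\omega$ or $\omega^\omega$, $E_0(Z)$ is eventual equality (agreement at all but finitely many coordinates) on $Z$; when the domain is not important it is written $E_0$. A relation is a triple $\mathbf{A}=(A_-,A_+,A)$ with $A\subset A_-\times A_+$. It is invariant if each of $A_-$, $A_+$ is a Borel subset of $2^\omega$ or of $\omega^\omega$, and whenever $x\mathrel{E_0(A_-)}x'$ and $y\mathrel{E_0(A_+)}y'$ we have $x\mathrel{A}y\iff x'\mathrel{A}y'$. A countable Borel equivalence relation $E$ on a standard Borel space $X$ (an equivalence relation that is Borel as a subset of $X\times X$ and all of whose classes are countable) is Borel non-$\mathbf{A}$ if for every Borel homomorphism $\phi\colon E\to E_{\mathsf{set}}(A_+)$ there exists a Borel homomorphism $\psi\colon E\to E_0(A_-)$ such that for all $x\in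 X$ and $n\in\omega$, $\neg(\psi(x)\mathrel{A}\phi(x)(n))$. $\leq_T$ is Turing reducibility on $2^\omega$, and $x\equiv_T y$ iff $x\leq_T y$ and $y\leq_T x$; $\equiv_T$ is a countable Borel equivalence relation on $2^\omega$. A cone is a set of the form $\{y\in 2^\omega: x\leq_T y\}$ for some $x\in 2^\omega$. Martin's Conjecture is the statement that any Borel homomorphism $f$ from $\equiv_T$ to $\equiv_T$ is either constant or $\leq_T$-increasing on a cone; that is, there is a cone $C$ such that either $f(C)$ is contained in a single $\equiv_T$-class, or $x\leq_T f(x)$ for all $x\in C$. The following known consequence of Martin's Conjecture may be used: if $f\colon\mathord{\equiv_T}\to E_0$ is a Borel homomorphism, then there exists a cone $C$ such that $f(C)$ is contained in a single $E_0$-class.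
   Formalization: The set A_+ is additionally assumed nonempty; for A_- = A_+ = ∅ the claim fails, since there is then no homomorphism φ into E_set(A_+) and the Turing equivalence relation is vacuously Borel non-A. *)

(* Defs.v *)
From Stdlib Require Cantor.
From mathcomp Require Import all_boot all_classical.
From mathcomp Require Import topology measurable_structure.

Set Implicit Arguments.
Unset Strict Implicit.
Unset Printing Implicit Defensive.

Local Open Scope classical_set_scope.

Definition borel (X : topologicalType) (B : set X) : Prop :=
  <<s [set U : set X | open U] >> B.

(* [measurable_fun] is not available here: the library's generated measurable
   types are pointed, and a subspace may be empty. *)
Definition borel_fun (X Y : topologicalType) (f : X -> Y) : Prop :=
  forall B : set Y, borel B -> borel (f @^-1` B).

Definition borel_hom (X Y : topologicalType)
    (E : X -> X -> Prop) (F : Y -> Y -> Prop) (f : X -> Y) : Prop :=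
  borel_fun f /\ forall x x', E x x' -> F (f x) (f x').

Inductive alphabet := two | omega.

Definition letter (k : alphabet) : topologicalType :=
  match k with two => bool | omega => nat end.

(* [letter k] is discrete, so these are the Cantor space and the Baire space
   with their product topologies. *)
Definition seqspace (k : alphabet) : topologicalType :=
  {ptws nat -> letter k}.

(* A subset of a space, used as a type, carries the topology induced by the
   inclusion. *)
Definition Eset (Z : topologicalType) (s t : {ptws nat -> Z}) : Prop :=
  range s = range t.

Definition E0 (k : alphabet) (Z : set (seqspace k)) (y y' : Z) : Prop :=
  exists N : nat, forall n : nat, (N <= n)%N -> val y n = val y' n.

Record relation_triple (S T : Type) := RelationTriple {
  lower : set S;
  upper : set T;
  related :> lower -> upper -> Prop }.

Definition invariant_triple (k l : alphabet)
    (A : relation_triple (seqspace k) (seqspace l)) : Prop :=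
  [/\ borel (lower A), borel (upper A) &
      forall (x x' : lower A) (y y' : upper A),
        E0 x x' -> E0 y y' -> (A x y <-> A x' y')].

(* Meant for a countable Borel equivalence relation [E] on a standard Borel
   space [X]; the formula itself does not use this. *)
Definition borel_non (k l : alphabet)
    (A : relation_triple (seqspace k) (seqspace l))
    (X : topologicalType) (E : X -> X -> Prop) : Prop :=
  forall phi : X -> {ptws nat -> upper A},
    borel_hom E (@Eset _) phi ->
    exists psi : X -> lower A,
      borel_hom E (@E0 k _) psi /\
      forall (x : X) (n : nat), ~ A (psi x) (phi x n).

(* Codes for the unary partial recursive functions relative to an
   oracle; several arguments are passed as one through the Cantor pairing. *)

Definition pair_code (a b : nat) : nat := Cantor.to_nat (a, b).
Definition fst_code (n : nat) : nat := (Cantor.of_nat n).1.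
Definition snd_code (n : nat) : nat := (Cantor.of_nat n).2.

Inductive code :=
  | Zero | Succ | Fst | Snd | Oracle
  | Pair of code & code
  | Comp of code & code
  | Prec of code & code
  | Mu of code.

Fixpoint iter_graph (base : nat -> Prop) (step : nat -> nat -> nat -> Prop)
    (m r : nat) : Prop :=
  if m is m'.+1 then exists2 v, iter_graph base step m' v & step m' v r
  else base r.

(* [computes o c n r]: with oracle [o], the computation [c] halts on input [n]
   with output [r].  With [<a, b>] for [pair_code a b]:
   [Prec c d] is f(<a, 0>) = c(a), f(<a, m + 1>) = d(<a, <m, f(<a, m>)>>);
   [Mu c] maps n to the least r with c(<n, r>) = 0, all the values c(<n, m>)
   for m < r being defined. *)
Fixpoint computes (o : nat -> nat) (c : code) (n r : nat) : Prop :=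
  match c with
  | Zero => r = 0
  | Succ => r = n.+1
  | Fst => r = fst_code n
  | Snd => r = snd_code n
  | Oracle => r = o n
  | Pair c d => exists a b, [/\ computes o c n a, computes o d n b & r = pair_code a b]
  | Comp c d => exists2 a, computes o d n a & computes o c a r
  | Prec c d =>
      let a := fst_code n in
      iter_graph (computes o c a)
        (fun m v w => computes o d (pair_code a (pair_code m v)) w) (snd_code n) r
  | Mu c =>
      computes o c (pair_code n r) 0 /\
      forall m, (m < r)%N -> exists v, computes o c (pair_code n m) v.+1
  end.

Definition turing_le (x y : seqspace two) : Prop :=
  exists c : code,
    forall n, computes (fun i => nat_of_bool (y i)) c n (nat_of_bool (x n)).

Definition turing_equiv (x y : seqspace two) : Prop :=
  turing_le x y /\ turing_le y x.

Definition cone (x : seqspace two) : set (seqspace two) :=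
  [set y | turing_le x y].

Definition martins_conjecture : Prop :=
  forall f : seqspace two -> seqspace two,
    borel_hom turing_equiv turing_equiv f ->
    exists w : seqspace two,
      (exists z, forall x, cone w x -> turing_equiv (f x) z) \/
      (forall x, cone w x -> turing_le x (f x)).

(* The known consequence of [martins_conjecture]: every Borel homomorphism
   from Turing equivalence to an [E0] maps a cone into a single class. *)
Definition E0_constant_on_cones : Prop :=
  forall (k : alphabet) (Z : set (seqspace k)), borel Z ->
  forall f : seqspace two -> Z,
    borel_hom turing_equiv (@E0 k Z) f ->
    exists w : seqspace two,
      exists z : Z, forall x, cone w x -> E0 (f x) z.

(* Main.v *)
Require Import Defs.
From Stdlib Require Cantor.
From mathcomp Require Import all_boot all_classical.
From mathcomp Require Import topology measurable_structure.

Local Open Scope classical_set_scope.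

(** Let [phi x] list the points of [upper A] that programs with oracle [x]
    produce, where a value at which the program diverges is read as 0; one fixed
    point of [upper A] stands in the places of the programs that produce no point
    of [upper A].  All points of [upper A] computable from [x] are listed.  The set listed depends only on the Turing degree of [x]: an oracle
    query can be replaced by a run of a program computing the oracle
    ([computes_relativize]), so every partial function computable from [x] is
    computable from every [y] above [x].  Suppose [psi] were a homomorphism to [E0] on [lower A]
    that avoids [phi].  Under Martin's Conjecture [psi] maps some cone, with base
    [w] say, into the [E0]-class of one point [z].  By totality [A z a] for some
    [a]; above the join of [w] and a real coding [a], the list [phi x] contains
    [a] ([computable_points_cone]) while [psi x] is [E0]-equivalent to [z].
    Invariance gives [A (psi x) a], a contradiction.

    What needs work is that [phi] is Borel ([borel_hom_computable_points]).
    Halting of a fixed program with a given output is arithmetical in the oracle,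
    hence Borel ([borel_computes]), so each coordinate of each entry of [phi] is
    Borel.  To pass from coordinates to [phi], every open subset of the target
    must be a countable union of sets whose preimages are under control; a
    countable network supplies these, and networks are inherited by subspaces
    ([network_set_type]) and by countable powers ([network_box]). *)

(** * Borel sets *)

Section BorelSets.
Context {X : topologicalType}.
Implicit Types (B : set X).

Lemma borel_open B : open B -> borel B.
Proof. exact: sub_sigma_algebra. Qed.

Lemma borel_not B : borel B -> borel [set x | ~ B x].
Proof. by move=> /sigma_algebraCD; rewrite setTD. Qed.

Lemma borel_const (P : Prop) : borel [set _ : X | P].
Proof.
have borel0 : borel (set0 : set X) by exact: sigma_algebra0.
have [p|np] := pselect P.
  suff -> : [set _ : X | P] = [set x | ~ set0 x] by exact: borel_not.
  by apply/seteqP; split => // x _ [].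
by suff -> : [set _ : X | P] = set0 by []; apply/seteqP; split.
Qed.

Lemma borel_exists (I : countType) (B : I -> set X) :
  (forall i, borel (B i)) -> borel [set x | exists i, B i x].
Proof.
move=> mB.
suff -> : [set x | exists i, B i x] =
    \bigcup_n (if unpickle n is Some i then B i else [set _ | False]).
  apply: sigma_algebra_bigcup => n.
  by case: (unpickle n) => [i|]; [exact: mB|exact: borel_const].
apply/seteqP; split => [x [i Bix]|x [n _]] /=.
  by exists (pickle i) => //; rewrite pickleK.
by case: (unpickle n) => // i Bix; exists i.
Qed.

Lemma borel_forall (I : countType) (B : I -> set X) :
  (forall i, borel (B i)) -> borel [set x | forall i, B i x].
Proof.
move=> mB.
suff -> : [set x | forall i, B i x] = [set x | ~ exists i, ~ B i x].
  by apply: borel_not; apply: borel_exists => i; exact: borel_not.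
apply/seteqP; split => x /= => [h [i]|h i]; first exact.
by apply: contrapT => nB; apply: h; exists i.
Qed.

Lemma borel_and B C : borel B -> borel C -> borel [set x | B x /\ C x].
Proof.
move=> mB mC.
suff -> : [set x | B x /\ C x] = [set x | forall b : bool, (if b then B else C) x].
  by apply: borel_forall => -[].
apply/seteqP; split => x /=; first by move=> [? ?] [].
by move=> h; split; [exact: (h true)|exact: (h false)].
Qed.

Lemma borel_or B C : borel B -> borel C -> borel [set x | B x \/ C x].
Proof.
move=> mB mC.
suff -> : [set x | B x \/ C x] = [set x | exists b : bool, (if b then B else C) x].
  by apply: borel_exists => -[].
apply/seteqP; split => x /=; last by case=> -[] ?; [left|right].
by case=> ?; [exists true|exists false].
Qed.

Lemma borel_guard (P : Prop) B :
  (P -> borel B) -> borel [set x | P -> B x].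
Proof.
move=> mB; have [p|np] := pselect P.
  by suff -> : [set x | P -> B x] = B; [exact: mB|apply/seteqP; split => x /=; auto].
suff -> : [set x | P -> B x] = [set _ | True] by exact: borel_const.
by apply/seteqP; split => x // _ /np.
Qed.

End BorelSets.

(** * Networks and Borel maps *)

(** Unlike the members of a base, those of a network need not be open, so the
    singletons of a countable space form one, whatever its topology. *)
Definition network {Y : topologicalType} {I : Type} (N : I -> set Y) : Prop :=
  forall (y : Y) (U : set Y), nbhs y U -> exists2 i, N i y & N i `<=` U.

(** Each open set is the union of the members of the network inside it, a
    countable union. *)
Lemma borel_fun_network {X Y : topologicalType} {I : countType}
    {N : I -> set Y} (f : X -> Y) :
  network N -> (forall i, borel (f @^-1` N i)) -> borel_fun f.
Proof.
move=> netN mN; apply: smallest_sub.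
  split.
  - exact: (borel_const False).
  - by move=> B mB; rewrite setTD; exact: borel_not.
  - move=> F mF; rewrite preimage_bigcup; exact: sigma_algebra_bigcup.
move=> U oU.
suff -> : f @^-1` U = [set x | exists i, N i `<=` U /\ N i (f x)].
  apply: borel_exists => i; apply: borel_and; first exact: borel_const.
  exact: mN.
apply/seteqP; split => x /= => [Ufx|[i [NU Nfx]]]; last exact: NU.
by have [i ? ?] := netN (f x) U (open_nbhs_nbhs (conj oU Ufx)); exists i.
Qed.

Lemma network_points {Y : topologicalType} {I : Type} {e : I -> Y} :
  (forall y, exists i, e i = y) -> network (fun i => [set e i]).
Proof.
move=> e_surj y U /nbhs_singleton Uy; have [i ei] := e_surj y.
by exists i => [|_ ->]; rewrite /= ei.
Qed.

Lemma network_set_type {Y : topologicalType} {I : Type} {N : I -> set Y}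
    (Z : set Y) :
  network N -> network (fun i => [set z : Z | N i (val z)]).
Proof.
move=> netN z U [V [[W oW WV] Vz VU]].
have Wz : W (val z) by have : V z by []; rewrite -WV.
have [i Niz NiW] := netN (val z) W (open_nbhs_nbhs (conj oW Wz)).
by exists i => // t /= Nit; apply: VU; rewrite -WV; exact: NiW.
Qed.

(** The sets of the form on the right, for fixed [g], are the base of a filter.
    It converges to [g] because it does so in each coordinate, and so it
    contains every neighborhood of [g]. *)
Lemma nbhs_ptws {Y : topologicalType} (g : {ptws nat -> Y})
    (W : set {ptws nat -> Y}) : nbhs g W ->
  exists (n : nat) (U : nat -> set Y), (forall i, nbhs (g i) (U i)) /\
    [set h : {ptws nat -> Y} | forall i, (i < n)%N -> U i (h i)] `<=` W.
Proof.
pose D := [set nU : nat * (nat -> set Y) | forall i, nbhs (g i) (nU.2 i)].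
pose box (nU : nat * (nat -> set Y)) :=
  [set h : {ptws nat -> Y} | forall i, (i < nU.1)%N -> nU.2 i (h i)].
have Fbox : Filter (filter_from D box).
  apply: filter_from_filter; first by exists (0, fun=> setT) => i /=; exact: filterT.
  move=> [n U] [m V] /= DU DV.
  exists (maxn n m, fun i => U i `&` V i) => [i|h /= hh]; first exact: filterI.
  by split=> i /= lti; have [] := hh i; rewrite // leq_max lti ?orbT.
suff cvg : filter_from D box --> g.
  by move=> /cvg [[n U] DU boxW]; exists n, U.
apply/cvg_sup => i; apply/cvg_image.
  by apply/seteqP; split => // y _; exists (fun=> y).
move=> V nV; exists [set h : {ptws nat -> Y} | V (h i)].
  exists (i.+1, fun j => if j == i then V else setT) => [j|h /=] /=.
    by case: eqP => [->//|_]; exact: filterT.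
  by move=> /(_ i (ltnSn i)) /=; rewrite eqxx.
apply/seteqP; split => [y [h Vh <-] //|y Vy].
by exists (fun=> y).
Qed.

(** A finite list of members of the network constrains the first coordinates;
    the others are free.  Lists of indices form a countable type, which keeps
    the network countable. *)
Definition box {Y : topologicalType} {I : Type} (N : I -> set Y) (s : seq I) :
    set {ptws nat -> Y} :=
  [set h : {ptws nat -> Y} | forall i,
    if onth s i is Some c then N c (h i) else True].

Lemma network_box {Y : topologicalType} {I : Type} {N : I -> set Y} :
  network N -> network (box N).
Proof.
move=> netN g W /nbhs_ptws[n [U [nU UW]]].
have /choice[c hc] : forall i, exists c, N c (g i) /\ N c `<=` U i.
  by move=> i; have [c ? ?] := netN _ _ (nU i); exists c.
have onthE i : onth (mkseq c n) i = if (i < n)%N then Some (c i) else None.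
  rewrite onthE -map_comp; case: ltnP => lin.
    by rewrite (nth_map 0) ?size_iota // nth_iota.
  by rewrite nth_default // size_map size_iota.
exists (mkseq c n) => [i|h hh].
  by rewrite onthE; case: ifP => // _; have [] := hc i.
by apply: UW => i lti; have := hh i; rewrite onthE lti; have [_] := hc i; apply.
Qed.

Lemma borel_box {X Y : topologicalType} {I : Type} {N : I -> set Y}
    (f : X -> {ptws nat -> Y}) (s : seq I) :
  (forall j i, borel [set x | N i (f x j)]) -> borel (f @^-1` box N s).
Proof.
move=> mf; apply: borel_forall => i.
by case: (onth s i) => [c|]; [exact: mf|exact: borel_const].
Qed.

Lemma borel_fun_ptws {X Y : topologicalType} {I : countType}
    {N : I -> set Y} (f : X -> {ptws nat -> Y}) :
  network N -> (forall j i, borel [set x | N i (f x j)]) -> borel_fun f.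
Proof.
move=> netN mf; apply: (borel_fun_network _ (network_box netN)) => s.
exact: borel_box.
Qed.

(** * Computations with an oracle *)

Local Notation orc x := (fun i => nat_of_bool (x i)).

Lemma computes_inj {o : nat -> nat} {c : code} {n r r' : nat} :
  computes o c n r -> computes o c n r' -> r = r'.
Proof.
elim: c n r r' => [||||| c IHc d IHd | c IHc d IHd | c IHc d IHd | c IHc] n r r' /=;
  try by move=> -> ->.
- move=> [a [b [ca db ->]]] [a' [b' [ca' db' ->]]].
  by rewrite (IHc _ _ _ ca ca') (IHd _ _ _ db db').
- by move=> [a da ca] [a' /(IHd _ _ _ da) <-]; exact: IHc.
- elim: (snd_code n) r r' => [|m IHm] r r' /=; first exact: IHc.
  by move=> [v iv dv] [v' /(IHm _ _ iv) <-]; exact: IHd.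
- move=> [cr rmin] [cr' rmin'].
  case: (ltngtP r r') => // [/rmin'|/rmin] [v cv].
    by have := IHc _ _ _ cr cv.
  by have := IHc _ _ _ cr' cv.
Qed.

(** The program [d] answers the oracle queries of [c]. *)
Fixpoint relativize (d c : code) : code :=
  match c with
  | Oracle => d
  | Pair a b => Pair (relativize d a) (relativize d b)
  | Comp a b => Comp (relativize d a) (relativize d b)
  | Prec a b => Prec (relativize d a) (relativize d b)
  | Mu a => Mu (relativize d a)
  | c => c
  end.

(** Only the query case is not formal: there [d] could have outputs besides
    the correct answer, which determinism ([computes_inj]) excludes. *)
Lemma computes_relativize (o o' : nat -> nat) (d : code) :
  (forall n, computes o' d n (o n)) ->
  forall c, computes o' (relativize d c) = computes o c.
Proof.
move=> dP; elim=> //= [|a IHa b IHb|a IHa b IHb|a IHa b IHb|a IHa];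
  rewrite ?IHa ?IHb //.
apply/funext => n; apply/funext => r; apply/propext; split => [|->//].
by move=> dr; exact: computes_inj dr (dP n).
Qed.

Lemma turing_le_computes (x y : seqspace two) : turing_le x y ->
  forall c, exists c', computes (orc y) c' = computes (orc x) c.
Proof. by move=> [d dx] c; exists (relativize d c); exact: computes_relativize. Qed.

Lemma fst_pair a b : fst_code (pair_code a b) = a.
Proof. by rewrite /fst_code /pair_code Cantor.cancel_of_to. Qed.

Lemma snd_pair a b : snd_code (pair_code a b) = b.
Proof. by rewrite /snd_code /pair_code Cantor.cancel_of_to. Qed.

Lemma pair_fst_snd n : pair_code (fst_code n) (snd_code n) = n.
Proof.
by rewrite /pair_code /fst_code /snd_code -surjective_pairing Cantor.cancel_to_of.
Qed.

Definition join (x y : seqspace two) : seqspace two :=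
  fun n => if fst_code n == 0 then x (snd_code n) else y (snd_code n).

Lemma turing_le_joinl x y : turing_le x (join x y).
Proof.
(* The pair of [Fst] and [Snd] is a program for the identity. *)
exists (Comp Oracle (Pair Zero (Pair Fst Snd))) => n /=.
exists (pair_code 0 n); last by rewrite /join fst_pair snd_pair.
exists 0, n; split => //.
by exists (fst_code n), (snd_code n); rewrite pair_fst_snd.
Qed.

Lemma turing_le_joinr x y : turing_le y (join x y).
Proof.
exists (Comp Oracle (Pair (Comp Succ Zero) (Pair Fst Snd))) => n /=.
exists (pair_code 1 n); last by rewrite /join fst_pair snd_pair.
exists 1, n; split => //; first by exists 0.
by exists (fst_code n), (snd_code n); rewrite pair_fst_snd.
Qed.

(** Embedding programs into a countable type makes them enumerable. *)
Fixpoint tree_of_code (c : code) : GenTree.tree nat :=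
  match c with
  | Zero => GenTree.Leaf 0
  | Succ => GenTree.Leaf 1
  | Fst => GenTree.Leaf 2
  | Snd => GenTree.Leaf 3
  | Oracle => GenTree.Leaf 4
  | Pair a b => GenTree.Node 0 [:: tree_of_code a; tree_of_code b]
  | Comp a b => GenTree.Node 1 [:: tree_of_code a; tree_of_code b]
  | Prec a b => GenTree.Node 2 [:: tree_of_code a; tree_of_code b]
  | Mu a => GenTree.Node 3 [:: tree_of_code a]
  end.

Fixpoint code_of_tree (t : GenTree.tree nat) : code :=
  match t with
  | GenTree.Leaf 1 => Succ
  | GenTree.Leaf 2 => Fst
  | GenTree.Leaf 3 => Snd
  | GenTree.Leaf 4 => Oracle
  | GenTree.Node 0 [:: a; b] => Pair (code_of_tree a) (code_of_tree b)
  | GenTree.Node 1 [:: a; b] => Comp (code_of_tree a) (code_of_tree b)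
  | GenTree.Node 2 [:: a; b] => Prec (code_of_tree a) (code_of_tree b)
  | GenTree.Node 3 [:: a] => Mu (code_of_tree a)
  | _ => Zero
  end.

Lemma tree_of_codeK : cancel tree_of_code code_of_tree.
Proof. by elim=> //= [a -> b ->|a -> b ->|a -> b ->|a ->]. Qed.

Definition code_of_nat (n : nat) : code := oapp code_of_tree Zero (unpickle n).

Lemma code_of_nat_surj c : exists n, code_of_nat n = c.
Proof.
by exists (pickle (tree_of_code c)); rewrite /code_of_nat pickleK /= tree_of_codeK.
Qed.

Lemma borel_letter (k : alphabet) (n : nat) (a : letter k) :
  borel [set x : seqspace k | x n = a].
Proof.
apply: borel_open.
have op : open [set a] by case: k a => a; exact: discrete_open.
have cont : continuous (fun x : seqspace k => x n).
  exact: (@proj_continuous nat (fun=> letter k) n).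
have := open_comp (fun x _ => cont x) op.
by apply.
Qed.

(** The definition of a halting computation quantifies over natural numbers
    only, and consults the oracle through single coordinates. *)
Lemma borel_computes (c : code) (n r : nat) :
  borel [set x : seqspace two | computes (orc x) c n r].
Proof.
elim: c n r => [||||| c IHc d IHd | c IHc d IHd | c IHc d IHd | c IHc] n r /=;
  try exact: borel_const.
- suff -> : [set x : seqspace two | r = nat_of_bool (x n)] =
      [set x | exists b : bool, r = b /\ x n = b].
    apply: borel_exists => b; apply: borel_and; first exact: borel_const.
    exact: (@borel_letter two).
  by apply/seteqP; split => [x /= ->|x /= [b [-> ->]]]; first by exists (x n).
- apply: borel_exists => a; apply: borel_exists => b.
  suff -> : (fun x : seqspace two => [/\ computes (orc x) c n a,
       computes (orc x) d n b & r = pair_code a b]) = [set x : seqspace two |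
      computes (orc x) c n a /\ (computes (orc x) d n b /\ r = pair_code a b)].
    apply: borel_and; first exact: IHc.
    by apply: borel_and; [exact: IHd|exact: borel_const].
  by apply/seteqP; split => x /= [cx dx]; [|case: dx].
- suff -> : [set x : seqspace two |
        exists2 a, computes (orc x) d n a & computes (orc x) c a r] =
      [set x | exists a, computes (orc x) d n a /\ computes (orc x) c a r].
    by apply: borel_exists => a; apply: borel_and; [exact: IHd|exact: IHc].
  by apply/seteqP; split => x /= => [[a da ca]|[a [da ca]]]; exists a.
- elim: (snd_code n) r => [|m IHm] r /=; first exact: IHc.
  set B := (X in borel X).
  pose C (v : nat) := [set x : seqspace two | computes (orc x) d
    (pair_code (fst_code n) (pair_code m v)) r].
  pose J (v : nat) := [set x : seqspace two |
    iter_graph (computes (orc x) c (fst_code n))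
     (fun m v w => computes (orc x) d
        (pair_code (fst_code n) (pair_code m v)) w) m v].
  suff -> : B = [set x | exists v, J v x /\ C v x].
    by apply: borel_exists => v; apply: borel_and; [exact: IHm|exact: IHd].
  by apply/seteqP; split => x /= => [[v iv dv]|[v [iv dv]]]; exists v.
- apply: borel_and; first exact: IHc.
  apply: borel_forall => m; apply: borel_guard => _.
  by apply: borel_exists => v; exact: IHc.
Qed.

(** * Points produced by programs with an oracle *)

Definition letter_of_nat (k : alphabet) : nat -> letter k :=
  match k with two => fun n => n != 0 | omega => id end.

Lemma letter_of_nat_surj k (a : letter k) : exists n, letter_of_nat k n = a.
Proof. by case: k a => a; [exists (nat_of_bool a); case: a|exists a]. Qed.

(** Reading 0 where the program diverges makes every program yield a point
    for every oracle, so that Borel measurability can be checked coordinate by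
    coordinate, without a condition of totality.  The extra points obtained in
    this way are harmless, since they too depend only on the graph of the
    partial function computed. *)
Definition output (k : alphabet) (c : code) (x : seqspace two) : seqspace k :=
  fun n => letter_of_nat k (xget 0 [set r | computes (orc x) c n r]).

Lemma borel_output k c : borel_fun (output k c).
Proof.
apply: (borel_fun_ptws _ (network_points (letter_of_nat_surj k))) => j i.
pose S x : set nat := [set r | computes (orc x) c j r].
(* A value read off at [j] is an actual output, or the default 0 when the
   program diverges at [j]. *)
suff -> : [set x | [set letter_of_nat k i] (output k c x j)] =
  [set x : seqspace two | exists r, letter_of_nat k r = letter_of_nat k i /\
     (S x r \/ (r = 0 /\ forall m, ~ S x m))].
  apply: borel_exists => r; apply: borel_and; first exact: borel_const.
  apply: borel_or; first exact: borel_computes.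
  apply: borel_and; first exact: borel_const.
  by apply: borel_forall => m; apply: borel_not; exact: borel_computes.
apply/seteqP; split => x /=; rewrite /output -/(S x).
  move=> e; exists (xget 0 (S x)); split => //.
  by case: xgetP => [r _ Sr|nS]; [left|right].
move=> [r [<- [Sr|[-> nS]]]]; congr (letter_of_nat k _).
  by case: xgetP => [r' _ Sr'|/(_ r)//]; exact: computes_inj Sr' Sr.
by case: xgetP => // r' _ /nS.
Qed.

Lemma output_turing_le k (x y : seqspace two) : turing_le x y ->
  forall c, exists c', output k c' y = output k c x.
Proof.
move=> /turing_le_computes xy c; have [c' e] := xy c.
by exists c'; rewrite /output e.
Qed.

(** The real [p] codes the complement of the graph of [a], so that a search for the
    first zero of [p] on the [j]-th section returns a code of the letter [a j].
    Coding is needed since [a] itself may lie in the Baire space. *)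
Lemma output_graph k (a : seqspace k) :
  exists c (p : seqspace two), output k c p = a.
Proof.
exists (Mu Oracle), (fun n => letter_of_nat k (snd_code n) != a (fst_code n)).
apply/funext => j; rewrite /output; case: xgetP => [r _ /= [+ _]|] /=.
  by rewrite fst_pair snd_pair; case: eqP.
have ex : exists n, letter_of_nat k n == a j.
  by have [n <-] := letter_of_nat_surj k (a j); exists n.
case: (ex_minnP ex) => r ra rmin /(_ r) []; split.
  by rewrite fst_pair snd_pair ra.
move=> m ltmr; exists 0; rewrite fst_pair snd_pair.
by case: eqP => // /eqP /rmin; rewrite leqNgt ltmr.
Qed.

(** * Listing the points of a Borel set produced from an oracle *)

Section Computable.
Context {l : alphabet} {Z : set (seqspace l)} (z0 : Z).

Definition computable_points (x : seqspace two) : {ptws nat -> Z} :=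
  fun i => insubd z0 (output l (code_of_nat i) x).

Lemma computable_points_le (x y : seqspace two) : turing_le x y ->
  range (computable_points x) `<=` range (computable_points y).
Proof.
move=> /(output_turing_le l) xy _ [i _ <-].
have [c' e] := xy (code_of_nat i); have [j ji] := code_of_nat_surj c'.
by exists j => //; rewrite /computable_points ji e.
Qed.

Lemma borel_hom_computable_points : borel Z ->
  borel_hom turing_equiv (@Eset _) computable_points.
Proof.
move=> mZ; split => [|x y [xy yx]]; last first.
  by apply/seteqP; split; exact: computable_points_le.
apply: (borel_fun_ptws _ (network_set_type Z (network_box
  (network_points (letter_of_nat_surj l))))) => j s.
set B := box _ s.
have mB : borel B.
  by apply: (borel_box id) => i n; exact: borel_letter.
pose f := output l (code_of_nat j).
suff -> : [set x | [set z : Z | B (val z)] (computable_points x j)] =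
    [set x | (Z (f x) /\ B (f x)) \/ (~ Z (f x) /\ B (val z0))].
  apply: borel_or; apply: borel_and.
  - exact: borel_output.
  - exact: borel_output.
  - by apply: borel_not; exact: borel_output.
  - exact: borel_const.
apply/seteqP; split => x /=; rewrite /computable_points val_insubd -/(f x).
  case: ifPn => [/set_mem Zx Bx|/negP nZx Bz0]; first by left.
  by right; split => // /mem_set.
by move=> [[/mem_set ->]|[nZx Bz0]] //; case: ifPn => // /set_mem.
Qed.

(** The base of the cone is a real coding [z]. *)
Lemma computable_points_cone (z : Z) :
  exists w, forall x, turing_le w x -> range (computable_points x) z.
Proof.
have [c [w wz]] := output_graph l (val z).
exists w => x /(output_turing_le l) wx.
have [c' xz] := wx c; have [i ic] := code_of_nat_surj c'.
by exists i => //; rewrite /computable_points ic xz wz valKd.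
Qed.

End Computable.

(** * Turing equivalence and total relations *)

Theorem theorem5p8 (k l : alphabet)
    (A : relation_triple (seqspace k) (seqspace l))
    (Ainv : invariant_triple A)
    (Aplus_nonempty : upper A !=set0)
    (Atotal : forall z : lower A, exists a : upper A, A z a)
    (MC : martins_conjecture)
    (MC_E0 : martins_conjecture -> E0_constant_on_cones) :
  ~ borel_non A turing_equiv.
Proof.
move=> nonA.
have [mlower mupper Aeq] := Ainv.
have [a0 Aa0] := Aplus_nonempty.
have z0 : upper A by exists a0; exact: mem_set.
have [psi [hpsi nApsi]] := nonA _ (borel_hom_computable_points z0 mupper).
have [w [z psiz]] := MC_E0 MC k (lower A) mlower psi hpsi.
have [a Aza] := Atotal z.
have [p pa] := computable_points_cone z0 a.
pose x := join w p.
have [n _ na] := pa x (turing_le_joinr w p).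
have psixz : E0 (psi x) z by exact: psiz (turing_le_joinl w p).
have aa : E0 a a by exists 0.
by apply: (nApsi x n); rewrite na; exact/(Aeq _ _ _ _ psixz aa).
Qed.
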